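(* Let $f:\mathbb{R}^+\to\mathbb{R}^+$ be non-decreasing with $f(x)\ge2$ for all $x>0$ and $f(x)\le\log x$ for all $x\ge e^2$. Let $0<\varepsilon<\frac1{100}$, $k:=200\lceil\frac1\varepsilon\log^4\frac1\varepsilon\rceil$, and let $\delta$ be defined by $1/\delta=16k^{f(k)-1}$. Let $H$ be an $h$-vertex graph with the $f$-Erdős–Hajnal property, and let $G$ be an $n$-vertex graph with fewer than $(\delta/k)^{h-1}n^h$ induced copies of $H$. Then there is $S\subseteq V(G)$ with $|S|\ge\delta n$ such that $G[S]$ has maximum degree at most $\varepsilon(|S|-1)$ or minimum degree at least $(1-\varepsilon)(|S|-1)$.
   Context: Logarithms are natural. A graph is $H$-free if it has no induced subgraph isomorphic to $H$. A homogeneous set is a clique or an independent set. $H$ has the $f$-Erdős–Hajnal property if for every real $k\ge1$, every $H$-free graph with at least $k^{f(k)}$ vertices has a homogeneous set of size at least $k$. *)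

(* Defs.v *)
From HB Require Import structures.
From mathcomp Require Import all_boot all_order all_algebra.
From mathcomp Require Import boolp reals sequences exp.

Set Implicit Arguments.
Unset Strict Implicit.
Unset Printing Implicit Defensive.

Import Order.TTheory GRing.Theory Num.Theory.

Record sgraph := SGraph {
  vertex :> finType;
  adj : rel vertex;
  adj_sym : symmetric adj;
  adj_irrefl : irreflexive adj }.

Definition induced_adj (G : sgraph) (S : {set G}) : rel {x : G | x \in S} :=
  fun x y => adj (val x) (val y).

Lemma induced_adj_sym (G : sgraph) (S : {set G}) :
  symmetric (@induced_adj G S).
Proof. by move=> x y; apply: adj_sym. Qed.

Lemma induced_adj_irrefl (G : sgraph) (S : {set G}) :
  irreflexive (@induced_adj G S).
Proof. by move=> x; apply: adj_irrefl. Qed.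

Definition induced (G : sgraph) (S : {set G}) : sgraph :=
  SGraph (@induced_adj_sym G S) (@induced_adj_irrefl G S).

Definition isomorphic (G H : sgraph) : Prop :=
  exists2 phi : G -> H,
    bijective phi & forall x y : G, adj (phi x) (phi y) = adj x y.

Definition free (H G : sgraph) : Prop :=
  forall S : {set G}, ~ isomorphic (induced S) H.

(* Copies are unlabelled: they are vertex subsets, not embeddings of H. *)
Definition induced_copies (H G : sgraph) : {set {set G}} :=
  [set S : {set G} | `[< isomorphic (induced S) H >]].

Definition clique (G : sgraph) (S : {set G}) : Prop :=
  {in S &, forall x y, x != y -> adj x y}.

Definition independent (G : sgraph) (S : {set G}) : Prop :=
  {in S &, forall x y, ~~ adj x y}.

Definition homogeneous (G : sgraph) (S : {set G}) : Prop :=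
  clique S \/ independent S.

Definition degree (G : sgraph) (x : G) : nat := #|[set y : G | adj x y]|.

Definition max_degree (G : sgraph) : nat := \max_(x : G) degree x.

(* Degrees are smaller than #|G|, so the default value #|G| of the iterated
   minimum only matters for the graph without vertices. *)
Definition min_degree (G : sgraph) : nat := \big[minn/#|G|]_(x : G) degree x.

Local Open Scope ring_scope.

Definition erdos_hajnal (R : realType) (f : R -> R) (H : sgraph) : Prop :=
  forall k : R, 1 <= k ->
  forall G : sgraph, free H G -> k `^ f k <= #|G|%:R ->
  exists2 S : {set G}, homogeneous S & k <= #|S|%:R.

(* Main.v *)
Require Import Defs.
From HB Require Import structures.
From mathcomp Require Import all_boot all_order all_algebra.
From mathcomp Require Import boolp reals sequences exp.
From mathcomp Require Import zify ring lra.

(* Suppose no S as required exists and put D = delta n.  Averaging over the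
   m-vertex subsets with m close to 2 k^f(k), most of which become H-free with at
   least k^f(k) vertices after a few deletions, shows that at least
   (n / m)^k / 2 of the k-subsets of G are homogeneous.  (If n < m, the whole
   graph is treated as one such subset, for a smaller value of k.)

   On the other hand every A with |A| >= D has a vertex with more than
   eps (|A| - 1) neighbours in A, and one with that many non-neighbours.  Let
   Z(A) be the sum of x^|S| over the independent S in A.  Branching on such a
   vertex v gives Z(A) <= Z(A - v) + x Z(A - v - N(v)), which yields, in the
   manner of Kleitman and Winston, Z(A) <= e^(x (D / (1 - eps) + 1)) (|A| / D)^p
   once x (1 - eps)^p n <= 1.  For x = k / D and p about ln (k / delta) / eps
   this allows fewer than (n / m)^k / 4 independent k-sets, and as many cliques. *)

Set Implicit Arguments.
Unset Strict Implicit.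
Unset Printing Implicit Defensive.

Import Order.TTheory GRing.Theory Num.Theory.

(** * Vertex deletion and averaging over the subsets of a fixed size *)

(** One point is picked from each member of [F] inside [B], and all of these are removed; a nonempty
    member always offers a point. *)
Lemma hitting_subset (T : finType) (F : {set {set T}}) (B : {set T}) :
  set0 \notin F ->
  exists2 B' : {set T}, B' \subset B &
    (forall X, X \in F -> ~~ (X \subset B')) /\
    #|B| <= #|B'| + #|[set X in F | X \subset B]|.
Proof.
move=> F0; pose C := [set X in F | X \subset B].
pose r (X : {set T}) := [pick x in X].
pose Z := [set x in B | Some x \in r @: C].
exists (B :\: Z); first exact: subsetDl.
split.
  move=> X XF; apply/negP => XB.
  have XB' : X \subset B by apply: subset_trans XB (subsetDl _ _).
  have XC : X \in C by rewrite inE XF.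
  have := imset_f r XC; rewrite /r; case: pickP => [x xX rX|X0 _].
    have := subsetP XB _ xX; rewrite !inE (subsetP XB' _ xX) /r rX.
    by [].
  by move: F0; have -> : set0 = X; [apply/setP=> x; rewrite inE X0 | rewrite XF].
rewrite -(cardsID Z B) addnC leq_add2l.
apply: leq_trans (leq_imset_card r C); rewrite -(card_imset _ (@Some_inj _)).
apply/subset_leq_card/subsetP => y /imsetP[x + ->].
by rewrite !inE => /andP[_ /andP[]].
Qed.

(** The ratio of the two binomials is the product of the factors [(m - i) / (n - i)] over [i < k],
    each at most [m / n]. It is the probability that a random [m]-subset contains a given
    [k]-set. *)
Lemma bin_falling_ratio (n m k : nat) : k <= m <= n ->
  'C(n - k, m - k) * n ^ k <= m ^ k * 'C(n, m).
Proof.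
elim: k => [|k IHk]; first by rewrite !subn0 !expn0 muln1 mul1n.
case/andP => km mn; have {IHk} := IHk _; rewrite (ltnW km) mn => /(_ isT) IHk.
have e : (n - k) * 'C(n - k.+1, m - k.+1) = (m - k) * 'C(n - k, m - k).
  by have := mul_bin_diag (n - k) (m - k.+1); rewrite -subnS subnSK.
have {e} : 'C(n - k.+1, m - k.+1) * n <= m * 'C(n - k, m - k).
  rewrite -(@leq_pmul2l (n - k)) ?subn_gt0 ?(leq_trans km) //.
  rewrite mulnA e mulnAC [leqRHS]mulnCA [leqRHS]mulnA leq_mul2r.
  by apply/orP; right; rewrite mulnBl mulnBr leq_sub // mulnC leq_mul2l mn orbT.
move=> H; rewrite !expnS.
apply: (@leq_trans (m * ('C(n - k, m - k) * n ^ k))).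
  by rewrite mulnA mulnA leq_mul2r H orbT.
by rewrite -mulnA leq_mul2l IHk orbT.
Qed.

(** The map from [B] to [B :\: X] is injective on the sets containing [X], and its values are
    [(m - #|X|)]-subsets of the complement of [X]. *)
Lemma card_draws_containing (T : finType) (X : {set T}) (m : nat) : m <= #|T| ->
  #|[set B : {set T} | (X \subset B) && (#|B| == m)]| * #|T| ^ #|X|
    <= m ^ #|X| * 'C(#|T|, m).
Proof.
move=> mT; have [Xm|Xm] := leqP #|X| m; last first.
  rewrite [X in X * _](_ : _ = 0) ?mul0n //; apply: eq_card0 => B; rewrite !inE.
  apply/negbTE/negP => /andP[/subset_leq_card XB /eqP Bm].
  by rewrite Bm leqNgt Xm in XB.
apply: (@leq_trans (_ * _)); last by apply: bin_falling_ratio; rewrite Xm.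
rewrite leq_mul2r; apply/orP; right.
have <- : #|~: X| = #|T| - #|X| by rewrite -(cardsC X) addKn.
rewrite -cards_draws -(@card_in_imset _ _ (fun B : {set T} => B :\: X)).
  apply/subset_leq_card/subsetP => _ /imsetP[B + ->]; rewrite !inE.
  case/andP => XB /eqP Bm; rewrite setDE subsetIr /= -setDE cardsD.
  by rewrite (setIidPr XB) Bm.
move=> B B'; rewrite !inE => /andP[XB _] /andP[XB' _] e.
by rewrite -(setID B X) -(setID B' X) e (setIidPr XB) (setIidPr XB').
Qed.

(** The pairs [X \subset B] are counted by [X] instead of [B]. After division this bounds the
    expected number of members of [F] in a random [m]-subset. *)
Lemma sum_copies_in_draws (T : finType) (F : {set {set T}}) (h m : nat) :
  m <= #|T| -> {in F, forall X : {set T}, #|X| = h} ->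
  (\sum_(B : {set T} | #|B| == m) #|[set X in F | X \subset B]|) * #|T| ^ h
    <= #|F| * (m ^ h * 'C(#|T|, m)).
Proof.
move=> mT Fh.
have -> : \sum_(B : {set T} | #|B| == m) #|[set X in F | X \subset B]|
   = \sum_(X in F) #|[set B : {set T} | (X \subset B) && (#|B| == m)]|.
  rewrite (eq_bigr (fun B : {set T} => \sum_(X in [set X in F | X \subset B]) 1));
    last by move=> B _; rewrite sum1_card.
  rewrite (exchange_big_dep (fun X => X \in F)) /=; last first.
    by move=> B X _; rewrite inE => /andP[].
  apply: eq_bigr => X XF; rewrite -sum1_card; apply: eq_bigl => B.
  by rewrite !inE XF andbC.
rewrite big_distrl /= -sum_nat_const; apply: leq_sum => X XF.
by rewrite -(Fh X XF) card_draws_containing.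
Qed.

Local Open Scope ring_scope.

(** * The independence polynomial and the method of Kleitman and Winston *)

(** The relation [e] is a parameter so that adjacency and non-adjacency both fit. *)
Definition stable (T : finType) (e : rel T) (S : {set T}) : bool :=
  [forall x in S, forall y in S, ~~ e x y].

(** The independence polynomial of [e] on [A], at the weight [x]. *)
Definition stable_sum (R : realType) (T : finType) (e : rel T) (x : R)
    (A : {set T}) : R :=
  \sum_(S : {set T} | (S \subset A) && stable e S) x ^+ #|S|.

Lemma stableP (T : finType) (e : rel T) (S : {set T}) :
  reflect {in S &, forall x y, ~~ e x y} (stable e S).
Proof.
apply: (iffP forall_inP) => [eS x y xS yS|eS x xS].
  by have /forall_inP := eS x xS; apply.
by apply/forall_inP => y yS; apply: eS.
Qed.

Lemma stable_sub (T : finType) (e : rel T) (S S' : {set T}) :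
  S' \subset S -> stable e S -> stable e S'.
Proof.
move=> /subsetP S'S /stableP eS; apply/stableP => x y xS yS.
by apply: eS; apply: S'S.
Qed.

Lemma stable_sum_mono (R : realType) (T : finType) (e : rel T) (x : R)
  (A B : {set T}) : 0 <= x -> A \subset B ->
  stable_sum e x A <= stable_sum e x B.
Proof.
move=> x0 AB; rewrite /stable_sum.
rewrite [leRHS](bigID (fun S : {set T} => S \subset A)) /=.
rewrite (eq_bigl (fun S : {set T} =>
    (S \subset B) && stable e S && (S \subset A))); last first.
  move=> S; case SA: (S \subset A); last by rewrite andbF.
  by rewrite (subset_trans SA AB) andbT.
by rewrite lerDl sumr_ge0 // => S _; rewrite exprn_ge0.
Qed.

(** The stable sets without [v] give the first term. Removing [v] from one that contains it leaves a
    stable set without neighbours of [v], at the price of a factor [x]. *)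
Lemma stable_sum_split (R : realType) (T : finType) (e : rel T) (x : R)
    (A : {set T}) (v : T) : 0 <= x -> v \in A ->
  stable_sum e x A <= stable_sum e x (A :\ v)
    + x * stable_sum e x (A :\ v :\: [set y | e v y]).
Proof.
move=> x0 vA; rewrite {1}/stable_sum.
rewrite (bigID (fun S : {set T} => v \in S)) /= addrC lerD //.
  rewrite /stable_sum le_eqVlt; apply/orP; left; apply/eqP/eq_bigl => S.
  by rewrite subsetD1 -!andbA [X in _ && X]andbC.
rewrite mulr_sumr.
rewrite (reindex_onto (fun S : {set T} => v |: S) (fun S => S :\ v)) /=; last first.
  by move=> S /andP[_ vS]; rewrite setD1K.
(* The sum on the right may also contain sets [S] for which [v |: S] is not stable; their terms are
   nonnegative and are dropped. *)
rewrite [leRHS](bigID (fun S : {set T} => (v |: S \subset A)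
  && stable e (v |: S) && (v \in v |: S) && ((v |: S) :\ v == S))) /=.
rewrite -[leLHS]addr0 lerD ?sumr_ge0 //; last first.
  by move=> S _; rewrite mulr_ge0 ?exprn_ge0.
rewrite le_eqVlt; apply/orP; left; apply/eqP; apply: eq_big => [S|S].
  apply/idP/idP => [/[dup] H ->|/andP[_ ->]//]; rewrite andbT.
  case/andP: H => /andP[/andP[SA st] _] /eqP Sv.
  rewrite (stable_sub (subsetUr _ _) st) andbT.
  have vS : v \notin S by rewrite -Sv !inE eqxx.
  apply/subsetP => y yS; rewrite !inE.
  move/stableP: st => /(_ v y); rewrite !inE eqxx yS orbT => /(_ isT isT) ->.
  have /subsetP/(_ y) := SA; rewrite !inE yS orbT => /(_ isT) ->.
  by rewrite andbT /=; apply: contraNneq vS => <-.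
case/andP => _ /eqP Sv; have vS : v \notin S by rewrite -Sv !inE eqxx.
by rewrite cardsU1 vS exprS.
Qed.

(** By the splitting, adding a vertex multiplies the sum by at most [1 + x <= expR x]. *)
Lemma stable_sum_le_expR (R : realType) (T : finType) (e : rel T) (x : R)
    (A : {set T}) : 0 <= x -> stable_sum e x A <= expR (x * #|A|%:R).
Proof.
move=> x0; move Am: #|A| => m; elim: m A Am => [|m IHm] A Am.
  rewrite (cards0_eq Am) /stable_sum mulr0 expR0.
  rewrite (eq_bigl (fun S => (S == set0) && stable e S)); last first.
    by move=> S; rewrite subset0.
  rewrite big_mkcondr big_pred1_eq cards0 expr0.
  by case: ifP.
have /card_gt0P[v vA] : (0 < #|A|)%N by rewrite Am.
have Av : #|A :\ v| = m by apply/eqP; rewrite -eqSS -Am (cardsD1 v A) vA.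
apply: le_trans (stable_sum_split e x0 vA) _.
have IH := IHm _ Av.
have mono := @stable_sum_mono R T e x (A :\ v :\: [set y | e v y]) (A :\ v) x0 (subsetDl _ _).
have {}mono : stable_sum e x (A :\ v :\: [set y | e v y]) <= expR (x * m%:R).
  exact: le_trans mono IH.
rewrite -natr1 mulrDr mulr1 addrC expRD.
have ex := expR_ge1Dx x; have e0 := expR_gt0 (x * m%:R).
nra.
Qed.

(** Induction on [a = #|A|]. Small sets obey the exponential bound; for large ones, branching at a
    dense vertex reduces the claim to [(a - 1) ^+ p + x * (1 - eps) ^+ p * a ^+ p <= a ^+ p]. *)
Lemma stable_sum_bound (R : realType) (T : finType) (e : rel T)
    (eps D x : R) (p : nat) :
  0 < eps < 1 -> 0 < D -> 0 <= x -> (0 < p)%N -> irreflexive e ->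
  x * (1 - eps) ^+ p * #|T|%:R <= 1 ->
  (forall A : {set T}, D <= #|A|%:R -> exists2 v, v \in A &
     eps * (#|A|%:R - 1) < #|[set y in A | e v y]|%:R) ->
  forall A : {set T}, stable_sum e x A
    <= expR (x * (D / (1 - eps) + 1)) * Num.max 1 (#|A|%:R / D) ^+ p.
Proof.
move=> /andP[e0 e1] D0 x0 p0 irr hx dense A.
set C := expR _; have C0 : 0 < C by apply: expR_gt0.
move Aa: #|A| => a; elim/ltn_ind: a A Aa => a IHa A Aa.
have q0 : 0 < 1 - eps by lra.
have max1 (y : R) : 1 <= Num.max 1 y by rewrite le_max lexx.
(* Above this threshold [(a - 1) / D] and [(1 - eps) * a / D] are at least 1, so the maximum can be
   bounded by a ratio in both branches. *)
have [sm|la] := leP (a%:R : R) (D / (1 - eps) + 1).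
  apply: le_trans (stable_sum_le_expR e A x0) _.
  rewrite Aa -[leLHS]mulr1 ler_pM ?expR_ge0 //.
    by rewrite ler_expR ler_wpM2l.
  by rewrite exprn_ege1.
have De : D <= D / (1 - eps) by rewrite ler_pdivlMr // ger_pMr //; lra.
have [|v vA hv] := dense A; first by rewrite Aa; lra.
rewrite Aa in hv.
apply: le_trans (stable_sum_split e x0 vA) _.
have a0 : (0 < a)%N by rewrite -Aa; apply/card_gt0P; exists v.
have Av : #|A :\ v| = a.-1 by rewrite -Aa (cardsD1 v A) vA.
have a1R : a.-1%:R = a%:R - 1 :> R by rewrite -subn1 natrB.
have h1 : stable_sum e x (A :\ v) <= C * ((a%:R - 1) / D) ^+ p.
  have := IHa a.-1 _ _ Av; rewrite prednK // => /(_ (leqnn _)).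
  rewrite a1R max_r //; rewrite ler_pdivlMr // mul1r; lra.
set B := A :\ v :\: _; have Ba : (#|B| < a)%N.
  apply: leq_ltn_trans (subset_leq_card (subsetDl _ _)) _.
  by rewrite Av prednK.
have BR : #|B|%:R <= (1 - eps) * a%:R.
  have : #|B|%:R = a%:R - 1 - #|[set y in A | e v y]|%:R :> R.
    rewrite -a1R -Av -natrB; last first.
      apply/subset_leq_card/subsetP => y; rewrite !inE => /andP[-> evy].
      by rewrite andbT; apply: contraTneq evy => ->; rewrite irr.
    congr _%:R; rewrite /B cardsD; congr (_ - #|pred_of_set _|)%N.
    apply/setP => y; rewrite !inE; case: eqP => [->|_] /=; last by [].
    by rewrite irr andbF.
  move=> ->; lra.
have h2 : stable_sum e x B <= C * ((1 - eps) * a%:R / D) ^+ p.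
  apply: le_trans (IHa _ Ba _ erefl) _.
  rewrite ler_pM2l // lerXn2r ?nnegrE ?(le_trans _ (max1 _)) //.
    by rewrite divr_ge0 ?mulr_ge0 //; lra.
  rewrite ge_max ler_pdivlMr // mul1r ler_pM2r ?invr_gt0 // BR andbT.
  by rewrite mulrC -ler_pdivrMr //; lra.
apply: le_trans (lerD h1 (ler_wpM2l x0 h2)) _.
rewrite max_r; last by rewrite ler_pdivlMr // mul1r; lra.
rewrite mulrCA -mulrDr ler_pM2l // !exprMn mulrA -mulrDl.
rewrite ler_pM2r ?exprn_gt0 ?invr_gt0 //.
have aR : (1 : R) <= a%:R by rewrite ler1n.
have aT : a%:R <= #|T|%:R :> R by rewrite ler_nat -Aa max_card.
(* This leaves room for one [a ^+ p.-1], which covers the second branch because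
   [x * (1 - eps) ^+ p * a <= 1]. *)
have q : (a%:R - 1) ^+ p <= (a%:R - 1) * a%:R ^+ p.-1 :> R.
  rewrite -[in leLHS](prednK p0) exprS ler_wpM2l //; first lra.
  by rewrite lerXn2r // ?nnegrE; lra.
apply: le_trans (lerD q (lexx _)) _.
have ap : a%:R ^+ p = a%:R * a%:R ^+ p.-1 :> R by rewrite -exprS prednK.
rewrite ap; have : 0 <= (a%:R : R) ^+ p.-1 by rewrite exprn_ge0.
set u := _ ^+ p.-1 => u0.
rewrite [leLHS](_ : _ = (a%:R - 1 + x * (1 - eps) ^+ p * a%:R) * u); last by ring.
rewrite ler_wpM2r //.
have : 0 <= x * (1 - eps) ^+ p by rewrite mulr_ge0 ?exprn_ge0 //; lra.
move: hx; set w := x * _; nra.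
Qed.

Lemma card_stable_le (R : realType) (T : finType) (e : rel T) (x : R) (j : nat) :
  0 <= x ->
  #|[set S : {set T} | stable e S && (#|S| == j)]|%:R * x ^+ j
    <= stable_sum e x [set: T].
Proof.
move=> x0; rewrite /stable_sum (bigID (fun S : {set T} => #|S| == j)) /=.
rewrite -[leLHS]addr0 lerD ?sumr_ge0 //; last by move=> S _; rewrite exprn_ge0.
rewrite (eq_bigr (fun=> x ^+ j)); last by move=> S /andP[_ /eqP ->].
rewrite sumr_const -[leRHS]mulr_natl ler_wpM2r ?exprn_ge0 //.
rewrite ler_nat leq_eqVlt; apply/orP; left; apply/eqP/eq_card => S.
by rewrite [RHS]/(_ \in _) /= !inE subsetT.
Qed.

(** * Numerical estimates for exponentials and logarithms *)

(** Both bounds are sixteenth powers of [1 + 1 / 16 <= expR (1 / 16) <= 1 / (1 - 1 / 16)], which is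
    [1 + y <= expR y] at plus and minus [1 / 16]. *)
Lemma expR1_bounds (R : realType) : 26 / 10 <= (expR 1 : R) <= 281 / 100.
Proof.
have e16 : expR 1 = expR (1 / 16) ^+ 16 :> R.
  by rewrite -expRM_natl; congr expR; field.
have lo : 17 / 16 <= expR (1 / 16) :> R.
  by apply: le_trans (expR_ge1Dx _); lra.
have hi : expR (1 / 16) <= 16 / 15 :> R.
  have := expR_ge1Dx (- (1 / 16) : R); rewrite expRN.
  have := expR_gt0 (1 / 16 : R); set z := expR _ => z0 h.
  have h2 : 15 / 16 <= z^-1 by lra.
  by rewrite -[z]invrK -[leRHS]invrK lef_pV2 ?posrE ?invr_gt0 //; lra.
have pos := expR_gt0 (1 / 16 : R).
apply/andP; split; rewrite e16.
  apply: (@le_trans _ _ ((17 / 16) ^+ 16)); first by lra.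
  by rewrite lerXn2r // ?nnegrE; lra.
apply: (@le_trans _ _ ((16 / 15) ^+ 16)); last by lra.
by rewrite lerXn2r // ?nnegrE; lra.
Qed.

Lemma expRn_le (R : realType) (n : nat) : expR n%:R <= (281 / 100) ^+ n :> R.
Proof.
have /andP[_ h] := expR1_bounds R.
rewrite -[n%:R]mulr1 expRM_natl lerXn2r // ?nnegrE ?expR_ge0 //; lra.
Qed.

(** The fifth power turns [44 / 10] into the integer 22, where the bound [281 / 100] on [expR 1] is
    good enough. *)
Lemma ln_100_ge (R : realType) (z : R) : 100 <= z -> 44 / 10 <= ln z.
Proof.
move=> hz; have z0 : 0 < z by lra.
rewrite -ler_expR lnK ?posrE //; apply: le_trans hz.
have p0 := expR_gt0 (44 / 10 : R).
rewrite leNgt; apply/negP => h.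
have := expRn_le R 22.
have -> : expR 22%:R = expR (44 / 10) ^+ 5 :> R.
  by rewrite -expRM_natl; congr expR; field.
have : 100 ^+ 5 <= expR (44 / 10) ^+ 5 :> R by rewrite lerXn2r // ?nnegrE; lra.
move=> h1 h2; have := le_trans h1 h2; lra.
Qed.

(* The factor 37 / 10 is chosen so that its fourth power stays below 200. *)
Lemma ln_k_le (R : realType) (eps k : R) : 0 < eps -> eps < 1 / 100 ->
  0 < k -> k <= 200 * (1 / eps * ln (1 / eps) ^+ 4 + 1) ->
  ln k <= 37 / 10 * ln (1 / eps).
Proof.
move=> e0 e1 k0 kle.
have ie : 100 <= 1 / eps by rewrite ler_pdivlMr //; lra.
have L0 := ln_100_ge ie; set L := ln (1 / eps) in L0 kle *.
have eL : expR L = 1 / eps by rewrite lnK // posrE; lra.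
rewrite -ler_expR lnK ?posrE //; apply: le_trans kle _.
(* The summand [L] yields the factor [1 / eps]; the fourth power of the rest has to beat
   [200 * L ^+ 4]. *)
rewrite (_ : 37 / 10 * L = L + 4%:R * (675 / 1000 * L)); last by field.
rewrite expRD expRM_natl -eL.
have lo : 377 / 100 * L <= expR (675 / 1000 * L).
  (* For the least [L] the exponent is about 3, so [1 + y <= expR y] is sharp enough once
     [expR 1 ^+ 3] is taken out. *)
  rewrite (_ : 675 / 1000 * L = 3%:R * 1 + (675 / 1000 * L - 3)); last by ring.
  rewrite expRD expRM_natl.
  have /andP[h _] := expR1_bounds R.
  have h3 : 17 <= expR 1 ^+ 3 :> R.
    apply: (@le_trans _ _ ((26 / 10) ^+ 3)); first lra.
    by rewrite lerXn2r // ?nnegrE; lra.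
  have := expR_ge1Dx (675 / 1000 * L - 3); set w := expR (_ - 3) => hw.
  have w0 : 0 <= w by apply: expR_ge0.
  nra.
have : (377 / 100 * L) ^+ 4 <= expR (675 / 1000 * L) ^+ 4.
  by rewrite lerXn2r // ?nnegrE ?expR_ge0 //; lra.
move=> h4; have eL100 : 100 <= expR L by rewrite eL.
apply: (@le_trans _ _ (expR L * (377 / 100 * L) ^+ 4)); last first.
  by rewrite ler_pM2l ?expR_gt0.
have L4 : 2 <= L ^+ 4.
  apply: (@le_trans _ _ (2 ^+ 4)); first lra.
  by rewrite lerXn2r // ?nnegrE; lra.
rewrite exprMn.
(* The excess over 200 pays for the rounding up in [k]. *)
have c : (377 / 100) ^+ 4 >= 2019 / 10 :> R by lra.
set c4 := (377 / 100) ^+ 4 in c *.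
have : expR L * (2019 / 10 * L ^+ 4) <= expR L * (c4 * L ^+ 4).
  by rewrite ler_pM2l ?expR_gt0 // ler_pM2r //; lra.
have : 100 * 2 <= expR L * L ^+ 4 by rewrite ler_pM //; lra.
lra.
Qed.

Lemma ln_16_le (R : realType) : ln 16 <= 3 :> R.
Proof.
rewrite -ler_expR lnK ?posrE //.
have /andP[h _] := expR1_bounds R.
rewrite -[3]mulr1 expRM_natl.
apply: (@le_trans _ _ ((26 / 10) ^+ 3)); first lra.
by rewrite lerXn2r // ?nnegrE ?expR_ge0 //; lra.
Qed.

Lemma ln_20000_ge (R : realType) (k : R) : 20000 <= k -> 7 <= ln k.
Proof.
move=> hk; rewrite -ler_expR lnK ?posrE; last lra.
by apply: le_trans (expRn_le R 7) _; lra.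
Qed.

(** In the expansion [- l ^+ 3 <= - 7 * l ^+ 2] outweighs [602 / 100 * l ^+ 2] and the constant. *)
Lemma quartic_bound (R : realFieldType) (l : R) : 7 <= l ->
  (l ^+ 2 + 302 / 100) * (l ^+ 2 - l + 3) <= l ^+ 4.
Proof.
move=> l7; have h2 : 7 * l <= l ^+ 2 by rewrite expr2; nra.
have h3 : 7 * l ^+ 2 <= l ^+ 3.
  by rewrite [in leRHS]exprS ler_wpM2r // exprn_ge0; lra.
have -> : (l ^+ 2 + 302 / 100) * (l ^+ 2 - l + 3) =
  l ^+ 4 - l ^+ 3 + 602 / 100 * l ^+ 2 - 302 / 100 * l + 906 / 100 by field.
move: h2 h3; generalize (l ^+ 2) (l ^+ 3) (l ^+ 4) => a b c h2 h3; lra.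
Qed.

Lemma k_ge_20000 (R : realType) (eps k : R) : 0 < eps -> eps < 1 / 100 ->
  200 * (1 / eps * ln (1 / eps) ^+ 4) <= k -> 20000 <= k.
Proof.
move=> e0 e1; have ie : 100 <= 1 / eps by rewrite ler_pdivlMr //; lra.
have L0 := ln_100_ge ie.
have L4 : 1 <= ln (1 / eps) ^+ 4.
  by rewrite exprn_ege1 // (le_trans _ L0) //; lra.
apply: le_trans.
have h : 100 * 1 <= 1 / eps * ln (1 / eps) ^+ 4 by rewrite ler_pM //; lra.
clear -h; lra.
Qed.

(** The coefficients of [K] add up to less than 2 and [expR 2 < 8]; the slack absorbs 12 and the
    factor 4, which is at most [expR 2]. *)
Lemma expR_lt_8Xn (R : realType) (K : nat) (z : R) : 20000 <= K%:R :> R ->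
  z <= 100 / 99 * K%:R + 12 + 938 / 1000 * K%:R -> 4 * expR z < 8 ^+ K.
Proof.
move=> kR hz; have /andP[elo ehi] := expR1_bounds R.
have e2 : expR 2 = expR 1 ^+ 2 :> R by rewrite -expRM_natl mulr1.
have e2lo : 4 <= expR 2 :> R.
  by rewrite e2 expr2; clear -elo; nra.
have e2hi : expR 2 < 8 :> R.
  by rewrite e2 expr2; clear -elo ehi; nra.
apply: (@le_lt_trans _ _ (expR 2 * expR z)).
  by rewrite ler_pM2r ?expR_gt0.
rewrite -expRD; apply: (@le_lt_trans _ _ (expR (K%:R * 2))).
  by rewrite ler_expR; clear -hz kR; lra.
rewrite expRM_natl ltrXn2r // ?nnegrE ?expR_ge0 //.
by rewrite -lt0n -(ltr0n R); clear -kR; lra.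
Qed.

(* Both factors of p ln (1 / delta) are close to ln k ^ 2, the first up to
   1 / eps, and 938 / 1000 exceeds (37 / 10) ^ 4 / 200. *)
Lemma fingerprint_cost (R : realType) (eps k fk delta : R) :
  0 < eps -> eps < 1 / 100 ->
  200 * (1 / eps * ln (1 / eps) ^+ 4) <= k ->
  k <= 200 * (1 / eps * ln (1 / eps) ^+ 4 + 1) ->
  2 <= fk -> fk <= ln k -> 0 < delta ->
  1 / delta = 16 * k `^ (fk - 1) ->
  exists2 p : nat, (0 < p)%N /\ k / delta <= expR (eps * p%:R) &
    p%:R * ln (1 / delta) <= 938 / 1000 * k.
Proof.
move=> e0 e1 kge kle f2 fl d0 dE.
have ie : 100 <= 1 / eps by rewrite ler_pdivlMr //; lra.
have L0 := ln_100_ge ie.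
have L4 : 1 <= ln (1 / eps) ^+ 4.
  by rewrite exprn_ege1 // (le_trans _ L0) //; lra.
have k20 := k_ge_20000 e0 e1 kge.
have k0 : 0 < k by apply: lt_le_trans k20.
have lk := ln_k_le e0 e1 k0 kle.
clear kle e1.
move: lk kge L0 L4; set L := ln (1 / eps) => lk kge L0 L4.
have l7 := ln_20000_ge k20; clear k20.
have l16 := ln_16_le R.
have l16' : 0 <= ln 16 :> R by rewrite ln_ge0 // ler1n.
have lnd : ln (1 / delta) = ln 16 + (fk - 1) * ln k.
  by rewrite dE lnM ?posrE ?powR_gt0 // ln_powR.
have id0 : 0 < 1 / delta by rewrite divr_gt0.
have lnkd : ln (k / delta) = ln 16 + fk * ln k.
  rewrite -[delta^-1]mul1r lnM ?posrE // lnd; ring.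
clear dE.
have kd0 : 0 < k / delta by rewrite divr_gt0.
set l := ln k in l7 lk fl lnd lnkd.
have lb : 0 <= ln (1 / delta) <= l ^+ 2 - l + 3.
  rewrite lnd; clear -l16 l16' l7 f2 fl; apply/andP; split; first nra.
  nra.
have lb2 : 0 < ln (k / delta) <= l ^+ 2 + 3.
  rewrite lnkd; clear -l16 l16' l7 f2 fl; apply/andP; split; first nra.
  nra.
clear lnd lnkd l16 l16' f2 fl.
case/andP: lb => lb0 lb; case/andP: lb2 => lb20 lb2.
(* The exponent with [expR (eps * x) = k / delta]; [p] is an integer above it by at most 1. *)
set x := ln (k / delta) / eps.
have x0 : 0 < x by rewrite divr_gt0.
exists (Num.truncn x).+1.
  split=> //; rewrite -[leLHS]lnK ?posrE // ler_expR.
  by rewrite [eps * _]mulrC -ler_pdivrMr //; apply/ltW/truncnS_gt.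
have p1 : (Num.truncn x).+1%:R <= x + 1.
  by rewrite -natr1 lerD2r truncn_le ltW.
apply: (@le_trans _ _ ((x + 1) * ln (1 / delta))); first by rewrite ler_wpM2r.
(* The rounding of [p] costs 1, which is less than [2 / 100] of [1 / eps]; hence [302 / 100] in
   place of 3. *)
have xb : x + 1 <= 1 / eps * (l ^+ 2 + 302 / 100).
  have h : x <= 1 / eps * (l ^+ 2 + 3).
    by rewrite /x mulrC div1r ler_pM2l ?invr_gt0.
  apply: (@le_trans _ _ (1 / eps * (l ^+ 2 + 3) + 1)); first by rewrite lerD2r.
  by clear -ie; rewrite !mulrDr -addrA lerD2l; lra.
apply: (@le_trans _ _ (1 / eps * (l ^+ 2 + 302 / 100) * (l ^+ 2 - l + 3))).
  by rewrite ler_pM // addr_ge0 // ltW.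
have ie0 : 0 < 1 / eps by rewrite divr_gt0.
rewrite -mulrA; apply: (@le_trans _ _ (1 / eps * l ^+ 4)).
  by rewrite ler_pM2l // quartic_bound.
have h : l ^+ 4 <= (37 / 10) ^+ 4 * L ^+ 4.
  by rewrite -exprMn lerXn2r // ?nnegrE; clear -l7 lk L0; lra.
(* The right side is 200 times [938 / 1000]. *)
have hc : (37 / 10) ^+ 4 <= 1876 / 10 :> R by clear; lra.
apply: (@le_trans _ _ (1 / eps * (1876 / 10 * L ^+ 4))).
  rewrite ler_pM2l // (le_trans h) // ler_wpM2r //.
  exact: le_trans ler01 L4.
rewrite mulrCA; clear -kge; lra.
Qed.

(** * Induced subgraphs and induced copies *)

Lemma card_induced (G : sgraph) (S : {set G}) : #|induced S| = #|S|.
Proof. by rewrite card_sig; apply: eq_card => x; rewrite !inE. Qed.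

Lemma isomorphic_induced_val (G H : sgraph) (A : {set G})
    (S : {set induced A}) :
  isomorphic (induced S) H ->
  isomorphic (induced [set val x | x in S]) H.
Proof.
case=> phi phi_bij phi_adj.
pose g (y : induced S) : induced [set val x | x in S] :=
  exist _ (val (val y)) (imset_f _ (valP y)).
have g_inj : injective g by move=> y z [/val_inj/val_inj].
have g_bij : bijective g.
  apply: inj_card_bij g_inj _.
  by rewrite !card_induced card_imset //; apply: val_inj.
case: g_bij => g' gK g'K.
exists (phi \o g'); first by apply: bij_comp => //; exists g.
by move=> x y; rewrite /= phi_adj -[in RHS](g'K x) -[in RHS](g'K y).
Qed.

Lemma free_induced (G H : sgraph) (A : {set G}) :
  (forall X, X \in induced_copies H G -> ~~ (X \subset A)) ->
  Defs.free H (induced A).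
Proof.
move=> noX S /isomorphic_induced_val iso.
have /noX/negP[] : [set val x | x in S] \in induced_copies H G.
  by rewrite inE; apply/asboolP.
by apply/subsetP => _ /imsetP[x _ ->]; apply: (valP x).
Qed.

Lemma erdos_hajnal_subset (R : realType) (f : R -> R) (G H : sgraph)
    (A : {set G}) (k : R) :
  erdos_hajnal f H -> 1 <= k -> k `^ f k <= #|A|%:R ->
  (forall X, X \in induced_copies H G -> ~~ (X \subset A)) ->
  exists S : {set G}, [/\ S \subset A, homogeneous S & k <= #|S|%:R].
Proof.
move=> EH k1 kA /free_induced noX.
have [|S homS kS] := EH k k1 _ noX; first by rewrite card_induced.
exists [set val x | x in S]; split.
- by apply/subsetP => _ /imsetP[x _ ->]; apply: (valP x).
- case: homS => [cl|ind]; [left|right].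
    move=> _ _ /imsetP[x xS ->] /imsetP[y yS ->] xy.
    by apply: (cl x y) => //; apply: contraNneq xy => ->.
  by move=> _ _ /imsetP[x xS ->] /imsetP[y yS ->]; apply: (ind x y).
- by rewrite card_imset //; apply: val_inj.
Qed.

Lemma card_induced_copy (G H : sgraph) (X : {set G}) :
  X \in induced_copies H G -> #|X| = #|H|.
Proof.
rewrite inE => /asboolP[phi phi_bij _].
by rewrite -(bij_eq_card phi_bij) card_induced.
Qed.

Lemma set0_induced_copy (G H : sgraph) : #|H| = 0%N ->
  set0 \in induced_copies H G.
Proof.
move=> H0; rewrite inE; apply/asboolP.
have noG (x : induced (set0 : {set G})) : False.
  by have := valP x; rewrite inE.
exists (fun x => match noG x with end); last by move=> x; case: (noG x).
apply: inj_card_bij; first by move=> x; case: (noG x).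
by rewrite H0 card_induced cards0.
Qed.

Lemma leq_card_copies_point (G H : sgraph) : #|H| = 1%N ->
  (#|G| <= #|induced_copies H G|)%N.
Proof.
move=> H1; rewrite -(card_imset _ (@set1_inj G)).
apply/subset_leq_card/subsetP => _ /imsetP[x _ ->]; rewrite inE; apply/asboolP.
have /card_gt0P[u _] : (0 < #|H|)%N by rewrite H1.
have eqx (y z : induced [set x]) : y = z.
  apply: val_inj; have := valP y; have := valP z.
  by rewrite !inE => /eqP -> /eqP ->.
exists (fun=> u); last by move=> y z; rewrite adj_irrefl (eqx y z) adj_irrefl.
apply: inj_card_bij => [y z _|]; first exact: eqx.
by rewrite H1 card_induced cards1.
Qed.

(** * Degrees and numbers of non-neighbours in induced subgraphs *)

Lemma degree_induced (G : sgraph) (A : {set G}) (x : induced A) :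
  degree x = #|[set y in A | adj (val x) y]|.
Proof.
rewrite /degree -(card_imset _ val_inj); apply: eq_card => y; rewrite !inE.
apply/imsetP/andP => [[z + ->]|[yA xy]].
  by rewrite inE => xz; split=> //; apply: (valP z).
by exists (exist _ y yA); rewrite ?inE.
Qed.

(** Adjacency in the complement graph; its stable sets are the cliques of [G]. *)
Definition coadj (G : sgraph) : rel G := fun x y => (x != y) && ~~ adj x y.

(** All degrees are [#|S| - 1] in a clique and 0 in an independent set. *)
Lemma homogeneous_low_or_high_degree (R : realType) (G : sgraph)
    (S : {set G}) (eps : R) : 0 <= eps -> (0 < #|S|)%N -> homogeneous S ->
  (max_degree (induced S))%:R <= eps * (#|S|%:R - 1) \/
  (1 - eps) * (#|S|%:R - 1) <= (min_degree (induced S))%:R.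
Proof.
move=> e0 S0; have S1 : 0 <= #|S|%:R - 1 :> R by rewrite subr_ge0 ler1n.
case=> [cl|ind]; [right|left].
  apply: (@le_trans _ _ (#|S|%:R - 1)); first by nra.
  apply: (big_ind (fun m => #|S|%:R - 1 <= m%:R :> R)).
  (* The default value of [min_degree] is the number of vertices, which is above the bound. *)
  - by rewrite card_induced; lra.
  - by move=> m n hm hn; rewrite /minn; case: ifP.
  move=> x _; rewrite degree_induced lerBlDr natr1 ler_nat.
  rewrite (cardsD1 (val x) S) (valP x) add1n ltnS.
  apply/subset_leq_card/subsetP => y; rewrite !inE => /andP[yx yS].
  by rewrite yS /= cl // ?(valP x) // eq_sym.
apply: (@le_trans _ _ 0); last by rewrite mulr_ge0.
apply: (big_ind (fun m => m%:R <= 0 :> R)) => //.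
  by move=> m n hm hn; rewrite /maxn; case: ifP.
move=> x _; rewrite degree_induced (_ : [set _ in _ | _] = set0) ?cards0 //.
apply/setP => y; rewrite !inE; apply/negbTE/negP => /andP[yS].
by apply/negP/ind => //; apply: (valP x).
Qed.

Lemma exists_high_degree (R : realType) (G : sgraph) (A : {set G}) (eps : R) :
  0 <= eps -> (0 < #|A|)%N ->
  ~ (max_degree (induced A))%:R <= eps * (#|A|%:R - 1) ->
  exists2 v, v \in A & eps * (#|A|%:R - 1) < #|[set y in A | adj v y]|%:R.
Proof.
move=> e0 A0 hmax; apply: contrapT => nov; apply: hmax.
have A1 : 0 <= #|A|%:R - 1 :> R by rewrite subr_ge0 ler1n.
apply: (big_ind (fun m => m%:R <= eps * (#|A|%:R - 1))).
- by rewrite mulr_ge0.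
- by move=> m n hm hn; rewrite /maxn; case: ifP.
move=> x _; rewrite degree_induced leNgt; apply/negP => h; apply: nov.
by exists (val x); first apply: (valP x).
Qed.

(** A vertex, its neighbours and its non-neighbours partition [A], so a degree below
    [(1 - eps) * (#|A| - 1)] forces more than [eps * (#|A| - 1)] non-neighbours. *)
Lemma exists_high_codegree (R : realType) (G : sgraph) (A : {set G}) (eps : R) :
  0 <= eps -> (0 < #|A|)%N ->
  ~ (1 - eps) * (#|A|%:R - 1) <= (min_degree (induced A))%:R ->
  exists2 v, v \in A & eps * (#|A|%:R - 1) < #|[set y in A | coadj v y]|%:R.
Proof.
move=> e0 A0 hmin; apply: contrapT => nov; apply: hmin.
have A1 : 0 <= #|A|%:R - 1 :> R by rewrite subr_ge0 ler1n.
apply: (big_ind (fun m => (1 - eps) * (#|A|%:R - 1) <= m%:R)).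
- by rewrite card_induced; nra.
- by move=> m n hm hn; rewrite /minn; case: ifP.
move=> x _; rewrite degree_induced leNgt; apply/negP => h; apply: nov.
exists (val x); first apply: (valP x).
have e : (#|A| = 1 + #|[set y in A | adj (val x) y]|
    + #|[set y in A | coadj (val x) y]|)%N.
  rewrite (cardsD1 (val x) A) (valP x) -addnA; congr (_ + _)%N.
  rewrite -(cardsID [set y | adj (val x) y]); congr (_ + _)%N; apply: eq_card => y.
    rewrite !inE; case: eqP => [->|_]; last by [].
    by rewrite adj_irrefl !andbF.
  by rewrite !inE /coadj eq_sym; case: (val x == y); rewrite /= ?andbF // andbC.
have : #|A|%:R = 1 + #|[set y in A | adj (val x) y]|%:R
    + #|[set y in A | coadj (val x) y]|%:R :> R by rewrite {1}e !natrD.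
move: h; set a : R := #|A|%:R; set b : R := _%:R; set c : R := _%:R.
clear; lra.
Qed.

(** * Lower and upper bounds on the number of homogeneous sets *)

Definition homogeneous_sets (G : sgraph) (j : nat) : {set {set G}} :=
  [set S : {set G} | `[< homogeneous S >] && (#|S| == j)].

Lemma card_homogeneous_sets (G : sgraph) (j : nat) :
  (#|homogeneous_sets G j| <=
   #|[set S : {set G} | stable (@adj G) S && (#|S| == j)]| +
   #|[set S : {set G} | stable (@coadj G) S && (#|S| == j)]|)%N.
Proof.
apply: leq_trans (leq_card_setU _ _); apply/subset_leq_card/subsetP => S.
rewrite !inE => /andP[/asboolP homS ->]; rewrite !andbT; apply/orP.
case: homS => [cl|ind]; [right|left]; apply/stableP => x y xS yS.
  rewrite /coadj negb_and !negbK; case: eqVneq => //= xy; exact: cl.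
exact: ind.
Qed.

Lemma homogeneous_subset (G : sgraph) (S : {set G}) (j : nat) :
  homogeneous S -> (j <= #|S|)%N ->
  exists2 S' : {set G}, S' \subset S & S' \in homogeneous_sets G j.
Proof.
move=> homS jS; have : (0 < #|[set X : {set G} | X \subset S & #|X| == j]|)%N.
  by rewrite cards_draws bin_gt0.
case/card_gt0P => X; rewrite inE => /andP[XS Xj]; exists X => //.
rewrite inE Xj andbT; apply/asboolP; have /subsetP sub := XS.
by case: homS => h; [left|right] => x y /sub xS /sub yS; apply: h.
Qed.

(** Each [m]-subset satisfies [m <= m * a1 + 4 * a2], where [a1] and [a2] count the members of [F1]
    and [F2] inside it. This is averaged over all [m]-subsets, and [sum_copies_in_draws] bounds both
    averages. *)
Lemma draws_alternative (R : realFieldType) (T : finType)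
    (F1 F2 : {set {set T}}) (h1 h2 m : nat) : (0 < m <= #|T|)%N ->
  {in F1, forall X : {set T}, #|X| = h1} ->
  {in F2, forall X : {set T}, #|X| = h2} ->
  (forall B : {set T}, #|B| = m -> #|[set X in F1 | X \subset B]| = 0%N ->
     (m <= 4 * #|[set X in F2 | X \subset B]|)%N) ->
  m%:R <= m%:R * (#|F1|%:R * (m%:R / #|T|%:R) ^+ h1)
          + 4 * (#|F2|%:R * (m%:R / #|T|%:R) ^+ h2) :> R.
Proof.
case/andP=> m0 mT F1h F2h alt.
have c0 : (0 < 'C(#|T|, m))%N by rewrite bin_gt0.
have n0 : 0 < #|T|%:R :> R by rewrite ltr0n (leq_trans m0).
pose s (F : {set {set T}}) :=
  (\sum_(B : {set T} | #|B| == m) #|[set X in F | X \subset B]|)%N.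
have sle (F : {set {set T}}) h : {in F, forall X : {set T}, #|X| = h} ->
    (s F)%:R <= 'C(#|T|, m)%:R * (#|F|%:R * (m%:R / #|T|%:R) ^+ h) :> R.
  move=> Fh; have := sum_copies_in_draws mT Fh.
  rewrite -(ler_nat R) !natrM !natrX => h'.
  rewrite expr_div_n mulrA mulrA ler_pdivlMr ?exprn_gt0 //.
  by apply: le_trans h' _; rewrite le_eqVlt; apply/orP; left; apply/eqP; ring.
have : ('C(#|T|, m) * m <= m * s F1 + 4 * s F2)%N.
  rewrite /s !big_distrr /= -big_split /=.
  have -> : ('C(#|T|, m) * m = \sum_(B : {set T} | #|B| == m) m)%N.
    rewrite sum_nat_const -cardsT -cards_draws; congr (_ * _)%N.
    by apply: eq_card => B; rewrite !inE subsetT.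
  apply: leq_sum => B /eqP Bm.
  have [F1B|F1B] := posnP #|[set X in F1 | X \subset B]|.
    by rewrite F1B muln0 add0n alt.
  by apply: leq_trans (leq_addr _ _); apply: leq_pmulr.
rewrite -(ler_nat R) natrD !natrM => h.
have c0R : 0 < 'C(#|T|, m)%:R :> R by rewrite ltr0n.
rewrite -(ler_pM2l c0R); apply: le_trans h _.
rewrite mulrDr [leRHS]addrC addrC; apply: lerD.
  by rewrite mulrCA ler_wpM2l // sle.
by rewrite mulrCA ler_wpM2l // sle.
Qed.

Lemma powR_subr1 (R : realType) (x y : R) : 0 < x -> x `^ y = x * x `^ (y - 1).
Proof.
move=> x0; have xn0 : x != 0 by rewrite gt_eqF.
have e : y = 1 + (y - 1) by ring.
by rewrite [in LHS]e (@powRD R x 1) ?xn0 ?implybT // powRr1 // ltW.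
Qed.

(* After deleting a vertex from each copy of H, a
   homogeneous set is already as large as required. *)
Lemma homogeneous_of_few_copies (R : realType) (f : R -> R) (G H : sgraph)
    (k : R) :
  (forall x y, 0 < x -> x <= y -> f x <= f y) -> 1 <= k -> 2 <= f k ->
  erdos_hajnal f H -> set0 \notin induced_copies H G ->
  (0 < #|G|)%N -> #|G|%:R <= 2 * k `^ f k ->
  #|induced_copies H G|%:R <= #|G|%:R / 8 :> R ->
  exists2 S : {set G}, homogeneous S &
    #|G|%:R <= 16 * k `^ (f k - 1) * #|S|%:R /\ 1 <= #|S|%:R :> R.
Proof.
move=> f_mono k1 f2 EH no0 n0 nle cle.
have k0 : 0 < k by apply: lt_le_trans k1.
have [B BT [noX Bge]] := hitting_subset setT no0.
have {Bge} Bge : 7 * #|G|%:R <= 8 * #|B|%:R :> R.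
  have : (#|G| <= #|B| + #|induced_copies H G|)%N.
    rewrite -cardsT; apply: leq_trans Bge _; rewrite leq_add2l.
    by apply/subset_leq_card/subsetP => X; rewrite inE => /andP[].
  rewrite -(ler_nat R) natrD; clear -cle; lra.
have n1 : 1 <= #|G|%:R :> R by rewrite ler1n.
have b1 : 1 <= #|B|%:R :> R.
  rewrite ler1n -(ltr0n R); clear -Bge n1; lra.
set b := #|B|%:R in b1 Bge *.
have f0 : 0 < f k by apply: lt_le_trans f2.
(* The property of [H] is applied at the smaller of [r] and [k]; if that is [r], monotonicity gives
   [f r <= f k], so [B] is large enough. *)
pose r := b `^ (f k)^-1.
have r1 : 1 <= r.
  by rewrite -(powRr0 b) ler_powR // invr_ge0 ltW.
have rf : r `^ f k = b by rewrite -powRrM mulVf ?gt_eqF // powRr1 // (le_trans ler01).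
have kf := powR_subr1 (f k) k0.
have kp : 0 < k `^ (f k - 1) by rewrite powR_gt0.
have [rk|kr] := leP r k.
  have r0 : 0 < r by apply: lt_le_trans r1.
  have [|S [_ homS rS]] := erdos_hajnal_subset EH r1 _ noX.
    by rewrite -/b -rf ler_powR // f_mono.
  exists S => //; split; last by apply: le_trans rS.
  have bf : b = r * r `^ (f k - 1) by rewrite -rf powR_subr1.
  have fr : r `^ (f k - 1) <= k `^ (f k - 1).
    rewrite ge0_ler_powR ?nnegrE ?(ltW r0) ?(ltW k0) //; clear -f2; lra.
  have : b <= k `^ (f k - 1) * #|S|%:R.
    by rewrite bf mulrC ler_pM ?powR_ge0 // ltW.
  have : 0 <= k `^ (f k - 1) * #|S|%:R by rewrite mulr_ge0 // ltW.
  by rewrite -mulrA; set w := _ * #|S|%:R; clear -Bge; lra.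
have [|S [_ homS kS]] := erdos_hajnal_subset EH k1 _ noX.
  rewrite -/b -rf ge0_ler_powR ?nnegrE ?(ltW k0) ?(ltW f0) //; last exact: ltW.
  by apply: le_trans (ltW kr); apply: ltW.
exists S => //; split; last by apply: le_trans kS.
have : k * k `^ (f k - 1) <= k `^ (f k - 1) * #|S|%:R by rewrite mulrC ler_pM2l.
have : 0 <= k `^ (f k - 1) * #|S|%:R by rewrite mulr_ge0 // ltW.
rewrite kf in nle.
rewrite -mulrA; set w := _ * #|S|%:R; move: nle; clear; lra.
Qed.

(** An [m]-set with fewer than [m / 4] copies of [H] keeps more than [3 * m / 4] vertices after the
    deletions, enough for a homogeneous [K]-set. In the average the copies contribute at most
    [m / 2], and the homogeneous sets must supply the rest. *)
Lemma many_homogeneous_sets (R : realType) (f : R -> R) (G H : sgraph)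
    (K m : nat) :
  1 <= K%:R :> R -> erdos_hajnal f H -> set0 \notin induced_copies H G ->
  (0 < #|H|)%N -> (0 < m <= #|G|)%N ->
  m%:R <= 2 * K%:R `^ f K%:R -> 4 * K%:R `^ f K%:R <= 3 * m%:R ->
  #|induced_copies H G|%:R * (m%:R / #|G|%:R) ^+ #|H| <= m%:R / 8 :> R ->
  1 <= 2 * (#|homogeneous_sets G K|%:R * (m%:R / #|G|%:R) ^+ K) :> R.
Proof.
move=> K1 EH no0 H0 mn mle mge cle.
have m0 : 0 < m%:R :> R by rewrite ltr0n; case/andP: mn.
have alt (B : {set G}) : #|B| = m ->
    #|[set X in homogeneous_sets G K | X \subset B]| = 0%N ->
    (m <= 4 * #|[set X in induced_copies H G | X \subset B]|)%N.
  move=> Bm nohom; rewrite leqNgt; apply/negP => few.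
  have [B' B'B [noX]] := hitting_subset B no0; rewrite Bm => Bge.
  have [|S [SB' homS KS]] := erdos_hajnal_subset EH K1 _ noX.
    have : 3 * m%:R <= 4 * #|B'|%:R :> R.
      rewrite -!natrM ler_nat; move: few Bge; clear; lia.
    move: mge; clear; lra.
  rewrite ler_nat in KS.
  have [X XS Xhom] := homogeneous_subset homS KS.
  have : X \in [set X in homogeneous_sets G K | X \subset B].
    by rewrite inE Xhom (subset_trans XS) // (subset_trans SB').
  by rewrite (cards0_eq nohom) inE.
have homK : {in homogeneous_sets G K, forall X : {set G}, #|X| = K}.
  by move=> X; rewrite inE => /andP[_ /eqP].
have copyh : {in induced_copies H G, forall X : {set G}, #|X| = #|H|}.
  by move=> X; apply: card_induced_copy.
have := draws_alternative R mn homK copyh alt.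
move: cle; set c := _ * _ ^+ #|H|; set d := _ * _ ^+ K => cle h.
rewrite -(ler_pM2l m0) mulr1; move: h cle; clear; lra.
Qed.

(** In the absence of a good [S], [stable_sum_bound] applies to [adj] and to [coadj]; the factor 2
    adds the two bounds. *)
Lemma few_homogeneous_sets (R : realType) (G : sgraph) (eps D x : R)
    (p K : nat) :
  0 < eps < 1 -> 0 < D -> 0 <= x -> (0 < p)%N ->
  x * (1 - eps) ^+ p * #|G|%:R <= 1 ->
  ~ (exists2 S : {set G}, D <= #|S|%:R &
      (max_degree (induced S))%:R <= eps * (#|S|%:R - 1) \/
      (1 - eps) * (#|S|%:R - 1) <= (min_degree (induced S))%:R) ->
  #|homogeneous_sets G K|%:R * x ^+ K
    <= 2 * (expR (x * (D / (1 - eps) + 1)) * Num.max 1 (#|G|%:R / D) ^+ p).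
Proof.
move=> eps01 D0 x0 p0 hx bad; have /andP[e0 _] := eps01.
have pos (A : {set G}) : D <= #|A|%:R -> (0 < #|A|)%N.
  by move=> DA; rewrite -(ltr0n R) (lt_le_trans D0).
have sadj : #|[set S : {set G} | stable (@adj G) S && (#|S| == K)]|%:R * x ^+ K
    <= expR (x * (D / (1 - eps) + 1)) * Num.max 1 (#|G|%:R / D) ^+ p.
  apply: le_trans (@card_stable_le R G (@adj G) x K x0) _; rewrite -cardsT.
  apply: stable_sum_bound => //; first exact: adj_irrefl.
  move=> A DA; apply: exists_high_degree; rewrite ?(ltW e0) ?pos // => deg.
  by apply: bad; exists A => //; left.
have scoadj : #|[set S : {set G} | stable (@coadj G) S && (#|S| == K)]|%:R
    * x ^+ K
    <= expR (x * (D / (1 - eps) + 1)) * Num.max 1 (#|G|%:R / D) ^+ p.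
  apply: le_trans (@card_stable_le R G (@coadj G) x K x0) _; rewrite -cardsT.
  apply: stable_sum_bound => //; first by move=> y; rewrite /coadj eqxx.
  move=> A DA; apply: exists_high_codegree; rewrite ?(ltW e0) ?pos // => deg.
  by apply: bad; exists A => //; right.
have := card_homogeneous_sets G K; rewrite -(ler_nat R) natrD => h.
rewrite [leRHS]mulr_natl mulr2n; apply: le_trans (lerD sadj scoadj).
by rewrite -mulrDl ler_wpM2r ?exprn_ge0.
Qed.

(** * Comparison of the two bounds *)

Theorem theorem2p5 (R : realType) (f : R -> R)
  (f_pos : forall x : R, 0 < x -> 0 < f x)
  (f_mono : forall x y : R, 0 < x -> x <= y -> f x <= f y)
  (f_ge2 : forall x : R, 0 < x -> 2 <= f x)
  (f_le_ln : forall x : R, expR 1 ^+ 2 <= x -> f x <= ln x)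
  (eps k delta : R)
  (eps_gt0 : 0 < eps) (eps_lt : eps < 1 / 100)
  (k_def : k = 200 * (Num.ceil (1 / eps * ln (1 / eps) ^+ 4))%:~R)
  (delta_def : 1 / delta = 16 * k `^ (f k - 1))
  (H G : sgraph)
  (H_EH : erdos_hajnal f H)
  (G_copies : #|induced_copies H G|%:R
                < (delta / k) ^+ (#|H| - 1) * #|G|%:R ^+ #|H|) :
  exists2 S : {set G},
    delta * #|G|%:R <= #|S|%:R &
    (max_degree (induced S))%:R <= eps * (#|S|%:R - 1) \/
    (1 - eps) * (#|S|%:R - 1) <= (min_degree (induced S))%:R.
Proof.
have [cge clt] : 200 * (1 / eps * ln (1 / eps) ^+ 4) <= k /\
    k <= 200 * (1 / eps * ln (1 / eps) ^+ 4 + 1).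
  have /andP[] := ceil_itv (1 / eps * ln (1 / eps) ^+ 4).
  rewrite intrB k_def; set c := _%:~R; set y := _ * _; clear.
  by move=> h1 h2; split; lra.
have k20 := k_ge_20000 eps_gt0 eps_lt cge.
have k1 : 1 <= k by apply: le_trans k20; clear; lra.
have k0 : 0 < k by apply: lt_le_trans k1.
pose K := (200 * `|Num.ceil (1 / eps * ln (1 / eps) ^+ 4)|)%N.
have kK : k = K%:R.
  rewrite k_def natrM natr_absz ger0_norm // ceil_ge0.
  apply: (@lt_le_trans _ _ 0); first by clear; lra.
  by move: clt k20; clear; lra.
clearbody K.
have kf0 : 0 < k `^ (f k - 1) by rewrite powR_gt0.
have id0 : 0 < 1 / delta by rewrite delta_def mulr_gt0.
have d0 : 0 < delta by rewrite div1r invr_gt0 in id0.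
have kfE := powR_subr1 (f k) k0.
have dE : delta * (16 * k `^ (f k - 1)) = 1.
  by rewrite -delta_def div1r mulfV // gt_eqF.
have dN : delta * (16 * k `^ f k) = k.
  by rewrite kfE; transitivity (k * (delta * (16 * k `^ (f k - 1))));
    [ring | rewrite dE mulr1].
have fk2 := f_ge2 k k0.
have kf1 : 1 <= k `^ (f k - 1).
  by rewrite -[leLHS](powRr0 k) ler_powR //; clear -fk2; lra.
have k_le_kf : k <= k `^ f k by rewrite kfE -[leLHS]mulr1 ler_pM2l.
have fkln : f k <= ln k.
  apply: f_le_ln; have /andP[_ h] := expR1_bounds R.
  apply: (@le_trans _ _ ((281 / 100) ^+ 2)).
    by rewrite lerXn2r // ?nnegrE ?expR_ge0 //; clear; lra.
  by apply: le_trans k20; clear; lra.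
(* If [#|H|] is 0 or 1, the exponent [#|H| - 1] is 0 and there would be fewer than 1, respectively
   [#|G|], copies; but the empty set, respectively every singleton, is one. *)
have H2 : (1 < #|H|)%N.
  rewrite ltnNge leq_eqVlt ltnS leqn0; apply/negP => /orP[] /eqP h.
    have := leq_card_copies_point G h; rewrite -(ler_nat R) leNgt.
    by move: G_copies; rewrite h subnn expr0 mul1r expr1 => ->.
  have := set0_induced_copy G h; move: G_copies.
  rewrite h sub0n !expr0 mul1r ltrn1 ltnS leqn0 => /eqP c0.
  by rewrite (cards0_eq c0) inE.
have H0 : (0 < #|H|)%N by apply: ltnW.
have no0 : set0 \notin induced_copies H G.
  by apply/negP => /card_induced_copy; rewrite cards0 => h; rewrite -h in H0.
have n0 : (0 < #|G|)%N.
  rewrite lt0n; apply/eqP => G0; move: G_copies.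
  by rewrite G0 expr0n (gtn_eqF H0) mulr0 ltrn0.
have n0R : 0 < #|G|%:R :> R by rewrite ltr0n.
have dk0 : 0 <= delta / k by rewrite divr_ge0 // ltW.
(* The expected number of copies in a random m-subset is at most m / 8. *)
have copies (m : R) : 0 <= m -> m <= 2 * k `^ f k ->
    #|induced_copies H G|%:R * (m / #|G|%:R) ^+ #|H| <= m / 8.
  move=> m0 mle; apply: (@le_trans _ _ ((delta / k) ^+ (#|H| - 1) * m ^+ #|H|)).
    rewrite expr_div_n mulrA ler_pdivrMr ?exprn_gt0 // mulrAC.
    by rewrite ler_wpM2r ?exprn_ge0 // ltW.
  rewrite subn1 -{2}(prednK H0) exprS mulrCA -exprMn ler_wpM2l //.
  have dm : delta / k * m <= 1 / 8.
    rewrite mulrAC ler_pdivrMr //.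
    apply: (@le_trans _ _ (delta * (2 * k `^ f k))); first by rewrite ler_wpM2l // ltW.
    by move: dN; clear; lra.
  have dm0 : 0 <= delta / k * m by rewrite mulr_ge0.
  have h1 : delta / k * m <= 1 by apply: le_trans dm _; clear; lra.
  rewrite -[8^-1]div1r; apply: le_trans _ dm.
  (* Since [#|H|] is at least 2, the exponent is positive and the power is at most its base. *)
  rewrite -[leRHS]expr1 ler_wiXn2l //.
  by rewrite -ltnS prednK.
(* The factor 2 ensures that three quarters of [m] still suffice for the property of [H], despite
   the rounding. *)
pose m := Num.truncn (2 * k `^ f k).
have N0 : 0 <= 2 * k `^ f k by rewrite mulr_ge0 // powR_ge0.
have mle : m%:R <= 2 * k `^ f k by rewrite truncn_le.
have mge : 4 * k `^ f k <= 3 * m%:R.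
  have : 2 * k `^ f k < m.+1%:R by apply: truncnS_gt.
  by rewrite -natr1; move: k_le_kf k20; clear; lra.
clearbody m.
have [small|large] := ltnP #|G| m.
  have nle : #|G|%:R <= 2 * k `^ f k.
    by apply: le_trans mle; rewrite ler_nat ltnW.
  have := copies _ (ltW n0R) nle.
  rewrite divff ?gt_eqF // expr1n mulr1 => few.
  have [S homS [nS S1]] :=
    homogeneous_of_few_copies f_mono k1 fk2 H_EH no0 n0 nle few.
  exists S; last first.
    by apply: homogeneous_low_or_high_degree; rewrite ?ltW // -(ltr0n R) (lt_le_trans ltr01).
  apply: (@le_trans _ _ (delta * (16 * k `^ (f k - 1) * #|S|%:R))).
    by rewrite ler_pM2l.
  by rewrite mulrA dE mul1r.
apply: contrapT => bad.
have m0 : (0 < m)%N.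
  by rewrite -(ltr0n R); move: mge k_le_kf k0; clear; lra.
have mn : (0 < m <= #|G|)%N by rewrite m0.
have m0R : 0 < m%:R :> R by rewrite ltr0n.
have many : 1 <= 2 * (#|homogeneous_sets G K|%:R * (m%:R / #|G|%:R) ^+ K) :> R.
  by apply: (many_homogeneous_sets _ H_EH no0 H0 mn); rewrite -?kK // copies // ltW.
have [p [p0 pge] ple] :=
  fingerprint_cost eps_gt0 eps_lt cge clt fk2 fkln d0 delta_def.
set D := delta * #|G|%:R in bad.
have D0 : 0 < D by rewrite mulr_gt0.
(* This makes the weight [x = k / D] at most 12. *)
have Dge : k / 12 <= D.
  apply: (@le_trans _ _ (delta * m%:R)); last by rewrite ler_pM2l // ler_nat.
  have : delta * (4 * k `^ f k) <= delta * (3 * m%:R) by rewrite ler_pM2l.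
  by move: dN; clear; lra.
have eps01 : 0 < eps < 1.
  by rewrite eps_gt0 /=; move: eps_lt; clear; lra.
have eps1 : 0 < 1 - eps by rewrite subr_gt0; case/andP: eps01.
pose x := k / D.
have x0 : 0 < x by rewrite divr_gt0.
have xp : x * (1 - eps) ^+ p * #|G|%:R <= 1.
  have -> : x * (1 - eps) ^+ p * #|G|%:R = k / delta * (1 - eps) ^+ p.
    by rewrite /x /D invfM; field; rewrite !gt_eqF.
  (* By the choice of [p] and by [1 - eps <= expR (- eps)]. *)
  apply: (@le_trans _ _ (expR (eps * p%:R) * expR (- eps) ^+ p)).
    rewrite ler_pM // ?divr_ge0 ?exprn_ge0 ?(ltW k0) ?(ltW d0) ?(ltW eps1) //.
    by rewrite lerXn2r // ?nnegrE ?expR_ge0 ?(ltW eps1) // expR_ge1Dx.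
  by rewrite -expRM_natl -expRD mulrC mulrN subrr expR0.
have := few_homogeneous_sets K eps01 D0 (ltW x0) p0 xp bad.
have -> : #|G|%:R / D = 1 / delta by rewrite /D; field; rewrite !gt_eqF.
rewrite max_r; last first.
  by rewrite delta_def; move: kf1; clear; lra.
have -> : (1 / delta) ^+ p = expR (p%:R * ln (1 / delta)).
  by rewrite expRM_natl lnK.
rewrite -expRD; set z := _ + _ => few.
(* The three summands bound [k / (1 - eps)], [x] and [p * ln (1 / delta)]. *)
have zle : z <= 100 / 99 * K%:R + 12 + 938 / 1000 * K%:R.
  rewrite -kK lerD // mulrDr mulr1 lerD //.
    rewrite /x mulrA divfK ?gt_eqF // mulrC ler_pM2r //.
    rewrite -[(1 - eps)^-1]div1r ler_pdivrMr //; move: eps_lt; clear; lra.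
  by rewrite ler_pdivrMr //; move: Dge; clear; lra.
have K20 : 20000 <= K%:R :> R by rewrite -kK.
(* It remains to derive the reverse inequality [8 ^+ K <= 4 * expR z] from the two counts. *)
have := expR_lt_8Xn K20 zle; rewrite ltNge => /negP; apply.
(* The 8 comes from [delta * m <= k / 8], a consequence of [dN]. *)
have mx : m%:R / #|G|%:R <= x / 8.
  have -> : m%:R / #|G|%:R = x * (delta * m%:R / k).
    by rewrite /x /D; field; rewrite !gt_eqF.
  rewrite ler_pM2l // ler_pdivrMr //.
  have : delta * m%:R <= delta * (2 * k `^ f k) by rewrite ler_pM2l.
  by move: dN; clear; lra.
have mxK : (m%:R / #|G|%:R) ^+ K <= x ^+ K / 8 ^+ K.
  by rewrite -expr_div_n lerXn2r // nnegrE divr_ge0 // ltW.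
have h8 : 0 < 8 ^+ K :> R by rewrite exprn_gt0.
have : #|homogeneous_sets G K|%:R * (m%:R / #|G|%:R) ^+ K <=
   #|homogeneous_sets G K|%:R * (x ^+ K / 8 ^+ K) :> R by rewrite ler_wpM2l.
rewrite mulrA ler_pdivlMr //; move: few many.
set hx := _ * x ^+ K; set hm := _ * _ ^+ K => few many hle.
have : 1 * 8 ^+ K <= 2 * hm * 8 ^+ K :> R by rewrite ler_pM2r.
by move: hle few; clear; lra.
Qed.
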